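(* Assume (A1), (A2), (A3) of the context and $l\le w^{\max}$ componentwise. Let $(w^\star,t^\star,f^\star)$ be the optimal solution of the convex problem $$\min_{(w,t,f)\in X'}\ \sum_{i=1}^{n-1} h\left(\lambda M\max\{\eta f_i,f_i\}+t_i\right)\quad\text{subject to the additional constraints } w_i\ge l_i,\ i=1,\dots,n.$$ Then its optimal value is equal to the optimal value of the non-convex problem $$\min_{(w,t,f)\in X}\ \sum_{i=1}^{n-1} h\left(\lambda M\max\{\eta f_i,f_i\}+t_i\right),$$ and the two problems share the same optimal solution.
   Context: Data: an integer $n\ge 2$; real constants $h,M,P_{\max},g,\mu,\gamma>0$, $c\ge 0$, $\lambda\ge 0$, $\eta\in[0,1]$; real angles $\alpha_1,\dots,\alpha_n$; boundary values $w_{\rm init},w_{\rm fin}\ge 0$; a vector $w^{\max}\in\mathbb{R}^n$ of nonnegative upper bounds with $w^{\max}_1=w_{\rm init}$, $w^{\max}_n=w_{\rm fin}$; and the vector $w^{\min}\in\mathbb{R}^n$ with $w^{\min}_1=w_{\rm init}$, $w^{\min}_n=w_{\rm fin}$, $w^{\min}_i=0$ for $2\le i\le n-1$. The set $X$ consists of all $(w,t,f)\in\mathbb{R}^n\times\mathbb{R}^{n-1}\times\mathbb{R}^{n-1}$ such that $w^{\min}_i\le w_i\le w^{\max}_i$ for $i=1,\dots,n$ (in particular $w_1=w_{\rm init}$, $w_n=w_{\rm fin}$), and, for $i=1,\dots,n-1$: $t_i=\frac{1}{\sqrt{w_i}}$ (so $w_i>0$); $t_i\ge \frac{M f_i}{P_{\max}}$;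 $f_i=\frac1h(w_{i+1}-w_i)+\gamma w_i+g(\sin\alpha_i+c)$; $-g\mu\le f_i\le g\mu$. The set $X'\supset X$ is defined by the same constraints, except that each equality $t_i=\frac{1}{\sqrt{w_i}}$ is replaced by the inequality $t_i\ge\frac{1}{\sqrt{w_i}}$ (with $w_i>0$), $i=1,\dots,n-1$. The critical value $\bar w>0$ is the solution of $\frac{P_{\max}}{M\sqrt{\bar w}}=g\mu$. Define $$\ell(w)=\begin{cases}(1-h\gamma)w+hg\mu & w\le\bar w,\\ (1-h\gamma)w+h\frac{P_{\max}}{M\sqrt w} & w>\bar w.\end{cases}$$ Assumptions: (A1) $(1-h\gamma)\bar w-hg(1+c)>\left(\frac{P_{\max}h}{2M(\lambda\gamma P_{\max}h+1-\lambda)}\right)^{2/3}$. (A2) $\min_{i\in I}\left[\frac{P_{\max}}{M}\sqrt{\frac{1-h\gamma}{\bar w+hg(\sin\alpha_i+c)}}-\frac{\gamma}{1-h\gamma}\left(\bar w+hg(\sin\alpha_i+c)\right)-g(\sin\alpha_i+c)\right]\ge 0$, where $I=\{i\in\{1,\dots,n\}: w^{\max}_i>\bar w\}$. (A3) $1-h\gamma-h\frac{P_{\max}}{2M\bar w^{3/2}}\ge 0$. The vector $l\in\mathbb{R}^n$ is defined by backward recursion: $l_n=w_{\rm fin}$, and for $j=n-1,\dots,1$, $l_j$ is the smallest real number $x\ge w^{\min}_j$ with $\ell(x)\ge l_{j+1}+hg(\sin\alpha_j+c)$. *)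

(* Defs.v *)
From HB Require Import structures.
From mathcomp Require Import all_boot all_order all_algebra.
From mathcomp Require Import all_classical all_reals ereal exp trigo.

Set Implicit Arguments.
Unset Strict Implicit.
Unset Printing Implicit Defensive.

Import Order.TTheory GRing.Theory Num.Theory.

Local Open Scope classical_set_scope.
Local Open Scope ring_scope.

(* The path has n = m + 1 sample points and m = n - 1 intervals; point i of
   1..n is the ordinal of value i - 1. *)

Record speed_data (R : realType) (m : nat) := SpeedData {
  step : R;                (* h *)
  mass : R;                (* M *)
  power_max : R;           (* P_max *)
  grav : R;                (* g *)
  friction : R;            (* mu *)
  drag : R;                (* gamma *)
  rolling : R;             (* c *)
  energy_weight : R;       (* lambda *)
  regen : R;               (* eta *)
  slope : 'rV[R]_m.+1;     (* alpha *)
  w_init : R;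
  w_fin : R;
  w_max : 'rV[R]_m.+1
}.

Record valid_data (R : realType) (m : nat) (d : speed_data R m) : Prop :=
  ValidData {
  step_gt0 : 0 < step d;
  mass_gt0 : 0 < mass d;
  power_max_gt0 : 0 < power_max d;
  grav_gt0 : 0 < grav d;
  friction_gt0 : 0 < friction d;
  drag_gt0 : 0 < drag d;
  rolling_ge0 : 0 <= rolling d;
  energy_weight_ge0 : 0 <= energy_weight d;
  regen_ge0 : 0 <= regen d;
  regen_le1 : regen d <= 1;
  w_init_ge0 : 0 <= w_init d;
  w_fin_ge0 : 0 <= w_fin d;
  w_max_ge0 : forall i, 0 <= w_max d 0 i;
  w_max_first : w_max d 0 ord0 = w_init d;
  w_max_last : w_max d 0 ord_max = w_fin d
}.

Section Definitions.

Context {R : realType} {m : nat}.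

Definition left_end (i : 'I_m) : 'I_m.+1 := widen_ord (leqnSn m) i.
Definition right_end (i : 'I_m) : 'I_m.+1 := lift ord0 i.

Definition plan : Type := ('rV[R]_m.+1 * 'rV[R]_m * 'rV[R]_m)%type.
Definition speed2 (p : plan) : 'rV[R]_m.+1 := p.1.1.  (* w *)
Definition slowness (p : plan) : 'rV[R]_m := p.1.2.   (* t *)
Definition force (p : plan) : 'rV[R]_m := p.2.        (* f *)

Implicit Types (d : speed_data R m) (l : 'rV[R]_m.+1) (p : plan).

Definition w_min d : 'rV[R]_m.+1 :=
  \row_i (if i == ord0 then w_init d
          else if i == ord_max then w_fin d else 0).

(* g (sin alpha_i + c) *)
Definition resistance d (i : 'I_m.+1) : R :=
  grav d * (sin (slope d 0 i) + rolling d).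

(* All constraints except the one linking t_i and 1 / sqrt w_i. *)
Definition common_constraints d p : Prop :=
  (forall i, w_min d 0 i <= speed2 p 0 i <= w_max d 0 i) /\
  (forall i : 'I_m,
    [/\ 0 < speed2 p 0 (left_end i),
        slowness p 0 i >= mass d * force p 0 i / power_max d,
        force p 0 i =
          1 / step d * (speed2 p 0 (right_end i) - speed2 p 0 (left_end i))
          + drag d * speed2 p 0 (left_end i) + resistance d (left_end i)
      & - (grav d * friction d) <= force p 0 i <= grav d * friction d]).

(* X *)
Definition exact_set d : set plan :=
  [set p | common_constraints d p /\
    forall i, slowness p 0 i = 1 / Num.sqrt (speed2 p 0 (left_end i))].

(* X' *)
Definition relaxed_set d : set plan :=
  [set p | common_constraints d p /\
    forall i, slowness p 0 i >= 1 / Num.sqrt (speed2 p 0 (left_end i))].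

Definition bounded_relaxed_set d l : set plan :=
  relaxed_set d `&` [set p | forall i, l 0 i <= speed2 p 0 i].

Definition cost d p : R :=
  \sum_(i < m) step d *
    (energy_weight d * mass d *
       Num.max (regen d * force p 0 i) (force p 0 i) + slowness p 0 i).

(* The value is +oo on an empty feasible set. *)
Definition optimal_value d (S : set plan) : \bar R :=
  ereal_inf [set (cost d p)%:E | p in S].

Definition optimal_solution d (S : set plan) p : Prop :=
  S p /\ forall q, S q -> cost d p <= cost d q.

Definition critical_value d (wbar : R) : Prop :=
  0 < wbar /\
  power_max d / (mass d * Num.sqrt wbar) = grav d * friction d.

Definition ell d (wbar w : R) : R :=
  if w <= wbar
  then (1 - step d * drag d) * w + step d * grav d * friction d
  else (1 - step d * drag d) * w
       + step d * (power_max d / (mass d * Num.sqrt w)).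

(* The first conjunct is automatic when lambda <= 1. For larger lambda it says
   that the base of the power 2/3 is well defined and positive; otherwise
   [powR] and division would return conventional values. *)
Definition assumption_A1 d (wbar : R) : Prop :=
  let D := energy_weight d * drag d * power_max d * step d
           + 1 - energy_weight d in
  0 < D /\
  (1 - step d * drag d) * wbar - step d * grav d * (1 + rolling d)
    > (power_max d * step d / (2 * mass d * D)) `^ (2 / 3).

(* The minimum over an empty index set is +oo. *)
Definition assumption_A2 d (wbar : R) : Prop :=
  let a i := wbar + step d * resistance d i in
  (0 <= \big[Order.min/+oo]_(i < m.+1 | (wbar < w_max d 0 i)%R)
      (power_max d / mass d * Num.sqrt ((1 - step d * drag d) / a i)
       - drag d / (1 - step d * drag d) * a i - resistance d i)%R%:E)%E.

Definition assumption_A3 d (wbar : R) : Prop :=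
  0 <= 1 - step d * drag d
       - step d * (power_max d / (2 * mass d * wbar `^ (3 / 2))).

Definition is_least (A : set R) (x : R) : Prop := A x /\ lbound A x.

(* The recursion determines [l] uniquely, from the last entry backwards. *)
Definition lower_profile d (wbar : R) l : Prop :=
  l 0 ord_max = w_fin d /\
  forall j : 'I_m,
    is_least [set x | w_min d 0 (left_end j) <= x /\
                ell d wbar x >= l 0 (right_end j)
                                + step d * resistance d (left_end j)]
             (l 0 (left_end j)).

End Definitions.

Arguments plan : clear implicits.

(* Main.v *)
(* Write l for the lower profile. Backward induction shows that every plan of X
   satisfies w >= l, so X is contained in the bounded relaxed set, and it
   suffices that optimal relaxed plans are exact. Suppose that the power bound
   f_i <= P_max / (M sqrt w_i) fails somewhere, and take the last such i. Then
   w_i > wbar, (A2) gives w_{i+1} > wbar, and monotonicity of ell, a consequence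
   of (A3), gives w_{i+1} > l_{i+1}; hence i + 1 < n, and f_{i+1} < g mu since
   the power bound holds at i + 1. Lowering w_{i+1} slightly is then feasible
   and, by (A3), lowers the cost. If the power bound holds everywhere,
   t_i = 1 / sqrt w_i is admissible, hence forced by optimality. *)

Require Import Defs.
From mathcomp Require Import all_boot all_order all_algebra.
From mathcomp Require Import all_classical all_reals ereal exp trigo.
From mathcomp Require Import ring lra.

Import Order.TTheory GRing.Theory Num.Theory.

Local Open Scope classical_set_scope.
Local Open Scope ring_scope.

(** * Estimates for the inverse square root *)

Lemma powR_3_2 (R : realType) (x : R) : 0 <= x -> x `^ (3 / 2) = Num.sqrt x ^+ 3.
Proof.
move=> x0; rewrite [3 / 2]mulrC powRrM powR12_sqrt//.
by rewrite (_ : 3 = 3%:R :> R)// powR_mulrn ?sqrtr_ge0.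
Qed.

(** The slope of 1 / sqrt on [b, +oo) is at most 1 / (2 b^(3/2)) in size. With u, v, c the roots of
    x, y, b, factoring v - u out of both sides leaves 2 c^3 <= u v (u + v). *)
Lemma inv_sqrt_lipschitz (R : realType) (b x y : R) : 0 < b -> b <= x -> x <= y ->
  (Num.sqrt x)^-1 - (Num.sqrt y)^-1 <= (y - x) / (2 * Num.sqrt b ^+ 3).
Proof.
move=> b0 bx xy.
have x0 := lt_le_trans b0 bx; have y0 := lt_le_trans x0 xy.
set u := Num.sqrt x; set v := Num.sqrt y; set c := Num.sqrt b.
have c0 : 0 < c by rewrite sqrtr_gt0.
have cu : c <= u by exact: ler_wsqrtr.
have uv : u <= v by exact: ler_wsqrtr.
have u0 := lt_le_trans c0 cu; have v0 := lt_le_trans u0 uv.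
have -> : y - x = (v - u) * (v + u).
  by rewrite -subr_sqr !sqr_sqrtr // ltW.
rewrite (_ : u^-1 - v^-1 = (v - u) / (u * v)); last by field; rewrite !gt_eqF.
rewrite -mulrA ler_wpM2l ?subr_ge0//.
rewrite ler_pdivlMr ?mulr_gt0 ?exprn_gt0// mulrC ler_pdivrMr ?mulr_gt0//.
have cv := le_trans cu uv.
have : c * c * (c + c) <= u * v * (v + u).
  by rewrite !(ler_pM, lerD, mulr_ge0, addr_ge0)// ltW.
by rewrite (_ : 2 * c ^+ 3 = c * c * (c + c)); [rewrite [_ * (u * v)]mulrC | ring].
Qed.

Lemma positive_below3 (R : realType) (x y z : R) : 0 < x -> 0 < y -> 0 < z ->
  exists2 e, 0 < e & [/\ e <= x, e <= y & e <= z].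
Proof.
move=> x0 y0 z0; exists (Num.min x (Num.min y z)).
  by rewrite !lt_min x0 y0.
by rewrite !ge_min !lexx !orbT.
Qed.

(** * Consequences of (A3) and monotonicity of [ell] *)

Section SpeedPlanning.

Context {R : realType} {m : nat} {d : speed_data R m}.
Hypothesis d_valid : valid_data d.
Context {wbar : R}.
Hypothesis wbar_critical : critical_value d wbar.
Hypothesis hA3 : assumption_A3 d wbar.

Let h := step d.
Let a := 1 - step d * drag d.
(** Changing a force by x / h changes the bound M f / P_max on the time by [kappa] x. *)
Let kappa := mass d / (step d * power_max d).
Let r (i : 'I_m) := resistance d (left_end i).

Let h0 : 0 < h := step_gt0 d_valid.
Let M0 : 0 < mass d := mass_gt0 d_valid.
Let P0 : 0 < power_max d := power_max_gt0 d_valid.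
Let wbar0 : 0 < wbar := wbar_critical.1.

Let kappa0 : 0 < kappa.
Proof. by rewrite divr_gt0 ?mulr_gt0. Qed.

Let a_ge : step d * (power_max d / (2 * mass d * Num.sqrt wbar ^+ 3)) <= a.
Proof. by move: hA3; rewrite /assumption_A3 powR_3_2 ?(ltW wbar0)// subr_ge0. Qed.

Let a0 : 0 < a.
Proof.
apply: lt_le_trans a_ge.
by rewrite !(mulr_gt0, invr_gt0, exprn_gt0, sqrtr_gt0)//.
Qed.

Let a1 : a < 1.
Proof. by rewrite /a ltrBlDr ltrDl mulr_gt0// (drag_gt0 d_valid). Qed.

(** (A3) says exactly that the slope bound 1 / (2 wbar^(3/2)) is at most [a * kappa]. *)
Lemma inv_sqrt_slope (x y : R) : wbar <= x -> x <= y ->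
  (Num.sqrt x)^-1 - (Num.sqrt y)^-1 <= a * kappa * (y - x).
Proof.
move=> bx xy; apply: le_trans (inv_sqrt_lipschitz _ _ _ _ wbar0 bx xy) _.
rewrite mulrC ler_wpM2r ?subr_ge0//.
have -> : (2 * Num.sqrt wbar ^+ 3)^-1 =
    step d * (power_max d / (2 * mass d * Num.sqrt wbar ^+ 3)) * kappa.
  rewrite /kappa; field; rewrite !(gt_eqF M0, gt_eqF P0, gt_eqF h0)/=.
  by rewrite gt_eqF// sqrtr_gt0.
by rewrite ler_wpM2r // ltW.
Qed.

Let force_scale (x w : R) : 0 < w ->
  (x <= power_max d / (mass d * Num.sqrt w)) = (mass d * x / power_max d <= (Num.sqrt w)^-1).
Proof.
move=> w0; have s0 : 0 < Num.sqrt w by rewrite sqrtr_gt0.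
rewrite ler_pdivlMr ?mulr_gt0// -[(Num.sqrt w)^-1]div1r ler_pdivlMr//.
by rewrite mulrAC ler_pdivrMr// mul1r mulrCA mulrA.
Qed.

Let power_le (x y : R) : 0 < x -> x <= y ->
  power_max d / (mass d * Num.sqrt y) <= power_max d / (mass d * Num.sqrt x).
Proof.
move=> x0 xy; have y0 := lt_le_trans x0 xy.
rewrite ler_pM2l// lef_pV2 ?posrE ?mulr_gt0 ?sqrtr_gt0//.
by rewrite ler_pM2l// ler_wsqrtr.
Qed.

Lemma ell_above (x : R) : wbar <= x ->
  ell d wbar x = a * x + h * (power_max d / (mass d * Num.sqrt x)).
Proof.
rewrite le_eqVlt => /predU1P[<-|bx]; rewrite /ell.
  by rewrite lexx wbar_critical.2 mulrA.
by rewrite leNgt bx.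
Qed.

(** Above [wbar] the gain a (y - x) of the linear term outweighs the loss of the power term, by
    [inv_sqrt_slope]; below [wbar] the function is affine of slope a > 0. *)
Lemma ell_le (x y : R) : x <= y -> wbar <= y -> ell d wbar x <= ell d wbar y.
Proof.
move=> xy by_.
have mono z : wbar <= z -> z <= y -> ell d wbar z <= ell d wbar y.
  move=> bz zy; rewrite !ell_above//.
  have := inv_sqrt_slope _ _ bz zy.
  have e w : h * (power_max d / (mass d * w)) = (w^-1) / kappa.
    rewrite /kappa invf_div invfM; rewrite /h; ring.
  rewrite !e => /(ler_wpM2r (ltW (_ : 0 < kappa^-1))).
  rewrite invr_gt0 kappa0 => /(_ isT).
  rewrite (_ : a * kappa * (y - z) / kappa = a * (y - z)); last first.
    by field; rewrite gt_eqF.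
  rewrite mulrBl mulrBr; lra.
have [xb|/ltW bx] := leP x wbar; last exact: mono.
apply: le_trans (mono _ (lexx _) by_).
by rewrite /ell xb lexx lerD2r ler_pM2l.
Qed.

(** Each branch of [ell] is a x plus h times one of the two force bounds, grip or power. *)
Lemma ell_ge (x y : R) : 0 < x -> y <= grav d * friction d ->
  mass d * y / power_max d <= (Num.sqrt x)^-1 -> a * x + h * y <= ell d wbar x.
Proof.
move=> x0 yf; rewrite -force_scale// => yp; rewrite /ell; case: ifP => _.
  by rewrite lerD2l -mulrA ler_pM2l.
by rewrite lerD2l ler_pM2l.
Qed.

Lemma next_speed2 (p : plan R m) (i : 'I_m) : common_constraints d p ->
  speed2 p 0 (right_end i) + h * r i = a * speed2 p 0 (left_end i) + h * force p 0 i.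
Proof.
case=> _ /(_ i)[_ _ -> _]; rewrite /a /h /r; field; exact: lt0r_neq0.
Qed.

(** * The lower profile and exact plans *)

Section Profile.

Context {l : 'rV[R]_m.+1}.
Hypothesis l_profile : lower_profile d wbar l.

Lemma exact_subset_bounded : exact_set d `<=` bounded_relaxed_set d l.
Proof.
move=> p [pc pt]; split; first by split=> // i; rewrite pt.
suff H k (i : 'I_m.+1) : (m - i = k)%N -> l 0 i <= speed2 p 0 i by move=> i; exact: H.
elim: k i => [|k IH] i ik.
  have -> : i = ord_max by apply/val_inj/eqP; rewrite /= eqn_leq -ltnS ltn_ord -subn_eq0 ik.
  have := pc.1 ord_max; rewrite l_profile.1 mxE.
  (* When m = 0 the first and last points coincide and [w_min] returns w_init, which then equals
     w_fin through [w_max]. *)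
  case: ifP => [/eqP e|_]; last by rewrite eqxx; case/andP.
  by rewrite -(w_max_last d_valid) -(w_max_first d_valid) -e; case/andP.
have im : (i < m)%N by rewrite -subn_gt0 ik.
have -> : i = left_end (Ordinal im) by exact: val_inj.
(* By leastness of l_j, it suffices that w_j lies in the set defining l_j. *)
set j := Ordinal im; apply: (l_profile.2 j).2; split.
  by case/andP: (pc.1 (left_end j)).
have [w0 tp _ /andP[_ fmu]] := pc.2 j.
apply: le_trans (ell_ge _ _ w0 fmu _); last by move: tp; rewrite pt div1r.
rewrite -(next_speed2 _ _ pc) lerD2r IH//=.
by rewrite /bump /= add1n subnS ik.
Qed.

(** * Intervals where the power bound fails *)

Definition power_violated (p : plan R m) (i : 'I_m) :=
  (Num.sqrt (speed2 p 0 (left_end i)))^-1 < mass d * force p 0 i / power_max d.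

Section Violation.

Context {p : plan R m}.
Hypothesis pc : common_constraints d p.
Context {i : 'I_m}.
Hypothesis pi : power_violated p i.

Let w := speed2 p 0 (left_end i).
Let w0 : 0 < w. Proof. by case: (pc.2 i). Qed.

Let f_gt : power_max d / (mass d * Num.sqrt w) < force p 0 i.
Proof. by move: pi; rewrite /power_violated !ltNge -force_scale. Qed.

Let f_gt0 : 0 < force p 0 i.
Proof. by apply: le_lt_trans f_gt; rewrite divr_ge0 ?mulr_ge0 ?sqrtr_ge0 ?ltW. Qed.

(** At or below [wbar] the power bound is at least g mu, so the grip bound enforces it. *)
Lemma violated_above : wbar < w.
Proof.
rewrite ltNge; apply/negP => /(power_le _ _ w0); rewrite wbar_critical.2 => H.
have [_ _ _ /andP[_ fmu]] := pc.2 i.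
by have := lt_le_trans (le_lt_trans H f_gt) fmu; rewrite ltxx.
Qed.

(** The chain is l_{i+1} + h r_i <= ell(l_i) <= ell(w_i) < a w_i + h f_i = w_{i+1} + h r_i; the
    strict step is the violation. *)
Lemma violated_next_gt_profile :
  (forall k, l 0 k <= speed2 p 0 k) -> l 0 (right_end i) < speed2 p 0 (right_end i).
Proof.
move=> lw; rewrite -(ltrD2r (h * r i)) (next_speed2 _ _ pc).
apply: le_lt_trans (l_profile.2 i).1.2 _.
apply: le_lt_trans (ell_le _ _ (lw _) (ltW violated_above)) _.
by rewrite ell_above ?(ltW violated_above)// ltrD2l ltr_pM2l.
Qed.

(* The speed from which coasting (zero force) leads to [wbar] is
   [v = (wbar + h r_i) / a]: above it any positive force ends above [wbar];
   below it, (A2) makes the full-power force exceed the one keeping the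
   speed constant. *)
Lemma violated_next_above : assumption_A2 d wbar -> wbar < speed2 p 0 (right_end i).
Proof.
move=> hA2; have next := next_speed2 _ i pc.
set v := (wbar + h * r i) / a.
have av : a * v = wbar + h * r i by rewrite /v mulrC divfK// gt_eqF.
have [vw|wv] := leP v w.
  have : 0 < h * force p 0 i by rewrite mulr_gt0.
  have : a * v <= a * w by rewrite ler_pM2l.
  rewrite -/w in next; lra.
have v0 : 0 < v by exact: lt_trans wv.
have wmax : wbar < w_max d 0 (left_end i).
  by apply: lt_le_trans violated_above _; case/andP: (pc.1 (left_end i)).
(* The bracket of (A2) at i is P_max / (M sqrt v) - gamma v - r_i. *)
have A2i : drag d * v + r i <= power_max d / (mass d * Num.sqrt v).
  have := hA2; rewrite /assumption_A2 => /bigmin_geP[_ /(_ (left_end i) wmax)].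
  rewrite lee_fin -/(r i) -/a -/h.
  rewrite -[a / _]invf_div -/v sqrtrV ?(ltW v0)//.
  rewrite -[drag d / a * _]mulrA [a^-1 * _]mulrC -/v.
  have -> : power_max d / (mass d * Num.sqrt v) = power_max d / mass d / Num.sqrt v.
    by rewrite invfM mulrA.
  lra.
have := power_le _ _ w0 (ltW wv).
have : drag d * w < drag d * v by rewrite ltr_pM2l// (drag_gt0 d_valid).
have b := violated_above.
move=> dv pv.
have : drag d * w + r i < force p 0 i by move: f_gt; lra.
rewrite -(ltr_pM2l h0) mulrDr => H.
have : a * w = w - h * (drag d * w) by rewrite /a /h; ring.
rewrite -/w in next; lra.
Qed.

End Violation.

Lemma next_index (i : 'I_m) : (i.+1 < m)%N -> {j : 'I_m | right_end i = left_end j}.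
Proof. by move=> im; exists (Ordinal im); exact: val_inj. Qed.

(* If the power bound fails at [i] but not at the next sample, lowering
   the speed in between shifts force from [i] to [i + 1]; both the energy and
   the time contribution saved at [i] exceed those added at [i + 1], the
   latter by (A3). *)
Lemma violated_improve (p : plan R m) (i j : 'I_m) :
  assumption_A2 d wbar -> bounded_relaxed_set d l p -> right_end i = left_end j ->
  power_violated p i -> ~~ power_violated p j ->
  exists2 q, bounded_relaxed_set d l q & cost d q < cost d p.
Proof.
move=> hA2 [[pc pt] pl] ij vi vj.
have ji : j != i.
  apply/eqP => e; move/(congr1 val): ij; rewrite e /= /bump /= add1n => /eqP.
  by rewrite gtn_eqF.
have bw := violated_next_above pc vi hA2.
have lw := violated_next_gt_profile pc vi pl.
rewrite ij in bw lw.
have [wj0 tj fj /andP[fj_ge fj_le]] := pc.2 j.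
have [wi0 ti fi /andP[fi_ge fi_le]] := pc.2 i.
pose w := speed2 p 0 (left_end j).
(* As w_j > wbar, the power bound at j is strictly below g mu. *)
have fj_lt : force p 0 j < grav d * friction d.
  rewrite lt_neqAle fj_le andbT; apply: contra vj => /eqP fje.
  rewrite /power_violated ltNge -force_scale// fje -wbar_critical.2 -ltNge.
  rewrite ltr_pM2l// ltf_pV2 ?posrE ?mulr_gt0 ?sqrtr_gt0//.
  by rewrite ltr_pM2l// ltr_sqrt.
(* Three limits on the decrease e of w_j: [slack] keeps the new t_i above 1 / sqrt w_i, [gap] keeps
   w_j above l_j and [wbar], and [room] keeps f_j below g mu. *)
have slack : 0 < (mass d * force p 0 i / power_max d
                   - (Num.sqrt (speed2 p 0 (left_end i)))^-1) / kappa.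
  by rewrite divr_gt0// subr_gt0.
have gap : 0 < Num.min (w - l 0 (left_end j)) (w - wbar).
  by rewrite lt_min !subr_gt0 lw bw.
have room : 0 < h * (grav d * friction d - force p 0 j).
  by rewrite mulr_gt0// subr_gt0.
have [e e0 [e_slack e_gap e_room]] := positive_below3 _ _ _ _ slack gap room.
move: e_slack; rewrite ler_pdivlMr// => e_slack.
move: e_gap; rewrite le_min => /andP[e_l e_bar].
have a_e : a * e <= e by rewrite ler_piMl ?ltW.
(* The force equations impose the changes -e / h at i and e / h - gamma e = a e / h at j; the times
   move by [kappa] h times as much, so t >= M f / P_max keeps its slack. *)
pose w' : 'rV[R]_m.+1 := \row_k (speed2 p 0 k - (if k == left_end j then e else 0)).
pose t' : 'rV[R]_m := \row_k (slowness p 0 k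
  + (if k == j then a * kappa * e else if k == i then - (kappa * e) else 0)).
pose f' : 'rV[R]_m := \row_k (force p 0 k
  + (if k == j then a * e / h else if k == i then - (e / h) else 0)).
have left_eq k : (left_end k == left_end j) = (k == j) by [].
have right_eq k : (right_end k == left_end j) = (k == i).
  by rewrite -ij (inj_eq lift_inj).
have kappaE x : mass d * (x / h) / power_max d = kappa * x.
  by rewrite /kappa /h; field; rewrite !(gt_eqF M0, gt_eqF P0, gt_eqF h0).
have wj'_le : wbar <= w - e by lra.
(* The new force at i still has M f / P_max >= 1 / sqrt w_i > 0. Its positivity gives the lower grip
   bound and removes the regeneration factor from its cost. *)
have fi'_gt0 : 0 < force p 0 i - e / h.
  have : 0 < mass d * (force p 0 i - e / h) / power_max d.
    apply: lt_le_trans (_ : (Num.sqrt (speed2 p 0 (left_end i)))^-1 <= _).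
      by rewrite invr_gt0 sqrtr_gt0.
    by rewrite mulrBr mulrBl kappaE; lra.
  by rewrite pmulr_lgt0 ?invr_gt0// pmulr_rgt0.
have eh0 : 0 < e / h by rewrite divr_gt0.
have ae_h : a * e / h <= e / h by rewrite ler_pM2r ?invr_gt0.
have ae_h0 : 0 < a * e / h by rewrite divr_gt0// mulr_gt0.
have e_room' : e / h <= grav d * friction d - force p 0 j.
  by rewrite ler_pdivrMr// mulrC.
exists (w', t', f').
  split; last first.
    move=> k /=; rewrite /speed2 /= mxE; case: eqP => [->|_]; last by rewrite subr0.
    rewrite -/(speed2 p) -/w; lra.
  split; last first.
    move=> k; rewrite /slowness /speed2 /= !mxE left_eq -/(slowness p) -/(speed2 p).
    have := pt k; rewrite !div1r.
    case: (eqVneq k j) => [->|kj].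
      (* By (A3), the rise of 1 / sqrt w_j is covered by the increase [a * kappa * e] of t_j. *)
      have := inv_sqrt_slope _ _ wj'_le (_ : w - e <= w).
      rewrite -/w (_ : w - (w - e) = e); last by ring.
      move=> /(_ _); lra.
    rewrite subr0; case: (eqVneq k i) => [->|ki]; last by rewrite addr0.
    lra.
  split=> [k|k].
    rewrite /speed2 /= [w' 0 k]mxE -/(speed2 p).
    have /andP[wm wM] := pc.1 k.
    case: eqP => [kj|_]; last by rewrite subr0 wm.
    (* The recursion gives l_j >= w_min_j, so staying above l_j suffices. *)
    have := (l_profile.2 j).1.1; rewrite -kj.
    move: e_l; rewrite /w -kj => ? ?; apply/andP; split; lra.
  rewrite /slowness /speed2 /force /= !mxE left_eq right_eq.
  rewrite -/(slowness p) -/(speed2 p) -/(force p).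
  have [wk0 tk fk /andP[fk_ge fk_le]] := pc.2 k.
  case: (eqVneq k j) => [kj|kj].
    rewrite kj (negPf ji) subr0; split.
    - by move: wj'_le wbar0; rewrite -/w; lra.
    - by rewrite mulrDr mulrDl kappaE; move: tj; lra.
    - by rewrite fj /a /h; field; exact: lt0r_neq0.
    - apply/andP; split; lra.
  rewrite subr0; case: (eqVneq k i) => [ki|ki]; last first.
    by rewrite subr0 !addr0; split=> //; apply/andP.
  rewrite ki; split=> //.
  - by rewrite mulrBr mulrBl kappaE lerD2r.
  - by rewrite fi /h; field; exact: lt0r_neq0.
  - have : 0 < grav d * friction d by rewrite mulr_gt0 ?(grav_gt0 d_valid) ?(friction_gt0 d_valid).
    by move=> ?; apply/andP; split; lra.
rewrite /cost (bigD1 i)//= (bigD1 j)//= [ltRHS](bigD1 i)//= [X in _ < _ + X](bigD1 j)//=.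
rewrite !addrA.
set S := \sum_(k < m | _) _; set S' := \sum_(k < m | _) _.
have -> : S = S'.
  apply: eq_bigr => k /andP[/negPf ki /negPf kj].
  by rewrite /force /slowness /= !mxE ki kj !addr0.
rewrite ltrD2r -!mulrDr ltr_pM2l//.
rewrite /force /slowness /= !mxE eqxx eq_sym (negPf ji) eqxx.
rewrite -/(force p) -/(slowness p).
set x := force p 0 i; set y := force p 0 j.
pose phi z := Num.max (regen d * z) z.
rewrite -!/(phi _).
(* Since eta <= 1, [phi] drops by the full e / h at i and rises by at most a e / h <= e / h at j. *)
have phi_pos z : 0 < z -> phi z = z.
  by move=> z0; apply/max_idPr; rewrite ler_piMl ?(ltW z0)// (regen_le1 d_valid).
have phi_add z u : 0 <= u -> phi (z + u) <= phi z + u.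
  move=> u0; rewrite /phi ge_max; apply/andP; split; last first.
    by rewrite lerD2r le_max lexx orbT.
  rewrite mulrDr lerD ?le_max ?lexx//.
  by rewrite ler_piMl// (regen_le1 d_valid).
have phi_sum : phi (x - e / h) + phi (y + a * e / h) <= phi x + phi y.
  rewrite (phi_pos _ fi'_gt0) (phi_pos x) ?(lt_trans fi'_gt0) ?ltrBlDr ?ltrDl//.
  rewrite -/x; have := phi_add y _ (ltW ae_h0); lra.
have : energy_weight d * mass d * (phi (x - e / h) + phi (y + a * e / h))
    <= energy_weight d * mass d * (phi x + phi y).
  by rewrite ler_wpM2l// mulr_ge0 ?(energy_weight_ge0 d_valid)// ltW.
(* The strict gain comes from the times, because a < 1; the energy weight may vanish. *)
have : a * kappa * e < kappa * e by rewrite -mulrA gtr_pMl ?(mulr_gt0 kappa0).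
rewrite !mulrDr; lra.
Qed.

(** * Optimal relaxed plans are exact *)

Lemma optimal_not_violated (p : plan R m) : assumption_A2 d wbar ->
  optimal_solution d (bounded_relaxed_set d l) p -> forall i, ~~ power_violated p i.
Proof.
move=> hA2 [pB pmin].
suff H k (i : 'I_m) : (m - i = k)%N -> ~~ power_violated p i by move=> i; exact: H.
elim: k i => [|k IH] i ik.
  by have := ltn_ord i; rewrite -subn_gt0 ik.
apply/negP => vi; have [[pc _] pl] := pB.
have [im|mi] := ltnP i.+1 m.
  have [j ij] := next_index i im.
  have jk : (m - j = k)%N.
    move/(congr1 val): ij; rewrite /= /bump /= add1n => <-.
    by rewrite subnS ik.
  have [q qB] := violated_improve p i j hA2 pB ij vi (IH j jk).
  by rewrite ltNge pmin.
have e : right_end i = ord_max.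
  by apply/val_inj/eqP; rewrite /= /bump /= add1n eqn_leq ltn_ord.
(* On the last interval w_n > l_n = w_fin contradicts w_n <= w_max_n = w_fin. *)
have := violated_next_gt_profile pc vi pl.
rewrite e l_profile.1 ltNge; case/andP: (pc.1 ord_max) => _.
by rewrite (w_max_last d_valid) => ->.
Qed.

Lemma optimal_exact (p : plan R m) : assumption_A2 d wbar ->
  optimal_solution d (bounded_relaxed_set d l) p -> exact_set d p.
Proof.
move=> hA2 popt; have nv := optimal_not_violated p hA2 popt.
have [[[pc pt] pl] pmin] := popt.
split=> // i; apply/eqP; rewrite eq_le pt andbT leNgt; apply/negP => ti.
(* Resetting all times to 1 / sqrt w is feasible without violations, raises no term of the cost and
   strictly lowers the one at i. *)
pose t' : 'rV[R]_m := \row_k (1 / Num.sqrt (speed2 p 0 (left_end k))).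
have /pmin : bounded_relaxed_set d l (speed2 p, t', force p).
  split=> //; split; last by move=> k; rewrite /slowness /= mxE.
  split=> [|k]; first exact: pc.1.
  have [wk0 tk fk fkb] := pc.2 k; split=> //.
  by rewrite /slowness /= mxE div1r leNgt; exact: nv.
rewrite leNgt => /negP; apply.
have t'E k : slowness (speed2 p, t', force p) 0 k = 1 / Num.sqrt (speed2 p 0 (left_end k)).
  by rewrite /slowness /= mxE.
rewrite /cost (bigD1 i)//= [ltRHS](bigD1 i)//=; apply: ltr_leD.
  by rewrite ltr_pM2l// ltrD2l t'E.
by apply: ler_sum => k _; rewrite ler_pM2l// lerD2l t'E.
Qed.

End Profile.

End SpeedPlanning.

Theorem proposition5p1 (R : realType) (m : nat) (n_ge2 : (2 <= m.+1)%N)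
    (d : speed_data R m) (d_valid : valid_data d)
    (wbar : R) (wbar_critical : critical_value d wbar)
    (hA1 : assumption_A1 d wbar)
    (hA2 : assumption_A2 d wbar)
    (hA3 : assumption_A3 d wbar)
    (l : 'rV[R]_m.+1) (l_profile : lower_profile d wbar l)
    (l_le_wmax : forall i, l 0 i <= w_max d 0 i)
    (pstar : plan R m)
    (pstar_opt : optimal_solution d (bounded_relaxed_set d l) pstar) :
  optimal_value d (bounded_relaxed_set d l) = optimal_value d (exact_set d) /\
  optimal_solution d (exact_set d) pstar /\
  (forall p : plan R m,
     optimal_solution d (bounded_relaxed_set d l) p <->
     optimal_solution d (exact_set d) p).
Proof.
have toX p : optimal_solution d (bounded_relaxed_set d l) p -> exact_set d p.
  exact: (optimal_exact d_valid wbar_critical hA3 l_profile).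
have XB := exact_subset_bounded d_valid l_profile.
have pX := toX _ pstar_opt.
have pmin := pstar_opt.2.
have pXopt : optimal_solution d (exact_set d) pstar.
  by split=> // q /XB; exact: pmin.
have value S : optimal_solution d S pstar -> optimal_value d S = (cost d pstar)%:E.
  case=> Sp Smin; apply/le_anti/andP; split.
    by apply: ereal_inf_lbound; exists pstar.
  by apply/ereal_infP => _ [q Sq <-]; rewrite lee_fin Smin.
split; first by rewrite !value.
split=> // p; split=> [popt|[Xp Xmin]].
  by split; [exact: toX | move=> q /XB; exact: popt.2].
split; first exact: XB.
(* [pstar] is itself exact, so an exact optimum costs no more than [pstar], hence no more than any
   bounded relaxed plan. *)
by move=> q Bq; apply: le_trans (pmin _ Bq); exact: Xmin.
Qed.
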